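(* Let $P$ be a monic element of $\mathcal{G}$, let $H=[h_{j,k}] = P X P^{-1}$, let $\{p_k(t)\}_{k\ge 0}$ be the polynomial sequence associated with $P$, and let $d(n,m,k)$ be the linearization coefficients of $\{p_k(t)\}_{k\ge 0}$. Then for all $n,m,k\in\mathbb{N}$, $$d(n+1,m,k) = d(n,m+1,k) + (h_{m,m}-h_{n,n})\, d(n,m,k) + \sum_{j=0}^{m-1} h_{m,j}\, d(n,j,k) - \sum_{j=0}^{n-1} h_{n,j}\, d(m,j,k).$$
   Context: $\mathbb{N}$ denotes the non-negative integers; empty sums are zero. All matrices are infinite, with complex entries and rows and columns indexed by $\mathbb{N}$. $\mathcal{G}$ is the group, under matrix multiplication, of the lower triangular matrices $A=[a_{j,k}]$ ($a_{j,k}=0$ for $j<k$) with $a_{k,k}\neq 0$ for all $k\ge 0$. An element of $\mathcal{G}$ is monic if all its entries on the main diagonal are equal to $1$. $X$ is the matrix with $X_{j,j+1}=1$ for $j\ge 0$ and all other entries zero. The polynomial sequence associated with $P\in\mathcal{G}$ is $p_k(t)=\sum_{j=0}^{k} P_{k,j}\,t^j$, $k\ge 0$. The linearization coefficients of $\{p_k(t)\}_{k\ge 0}$ are the unique numbers $d(n,m,k)$, $n,m,k\in\mathbb{N}$, such that $p_n(t)p_m(t)=\sum_{k=0}^{n+m} d(n,m,k)\,p_k(t)$ for all $n,m$, with $d(n,m,k)=0$ for $k>n+m$. *)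

(* Defs.v *)
From HB Require Import structures.
From mathcomp Require Import all_boot all_order all_algebra.
From mathcomp Require Import boolp classical_sets functions cardinality fsbigop reals.
From mathcomp Require Export complex.

Set Implicit Arguments.
Unset Strict Implicit.
Unset Printing Implicit Defensive.

Import GRing.Theory.
Local Open Scope ring_scope.
Local Open Scope classical_set_scope.

Definition imatrix (F : Type) : Type := nat -> nat -> F.
Identity Coercion fun_of_imatrix : imatrix >-> Funclass.

Section InfiniteMatrices.
Variable F : fieldType.
Implicit Types A B C : imatrix F.

(* The sum over nat is a finitely supported one: it has its usual meaning      *)
(* whenever A i j * B j k <> 0 for finitely many j only (for instance when A   *)
(* has finite rows), and the junk value 0 otherwise.                           *)
Definition immul A B : imatrix F :=
  fun i k => \sum_(j \in [set: nat]) A i j * B j k.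

Definition imone : imatrix F := fun i k => (i == k)%:R.

Definition imshift : imatrix F := fun i k => (k == i.+1)%:R.

Definition lower_triangular A : Prop := forall j k, (j < k)%N -> A j k = 0.

Lemma immul_rowfinite A B N i k : (forall j, (N <= j)%N -> A i j = 0) ->
  immul A B i k = \sum_(j < N) A i j * B j k.
Proof.
move=> A0; rewrite /immul (fsbigE (iota 0 N)) ?iota_uniq//; last first.
  move=> j _; rewrite mem_iota add0n leq0n /= -leqNgt => /A0 ->.
  by rewrite mul0r.
rewrite (eq_bigl xpredT) => [|j]; last exact: in_setT.
by rewrite -{1}(subn0 N) -/(index_iota 0 N) big_mkord.
Qed.

Lemma immul_lower A B N i k : lower_triangular A -> (i < N)%N ->
  immul A B i k = \sum_(j < N) A i j * B j k.
Proof.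
by move=> lA iN; apply: immul_rowfinite => j Nj; apply/lA/(leq_trans iN).
Qed.

Lemma lower_mul A B : lower_triangular A -> lower_triangular B ->
  lower_triangular (immul A B).
Proof.
move=> lA lB i k ik; rewrite (immul_lower _ _ lA (ltnSn i)) big1// => j _.
by rewrite (lB j k) ?mulr0// (leq_ltn_trans _ ik)// -ltnS.
Qed.

Lemma diag_mul A B k : lower_triangular A -> lower_triangular B ->
  immul A B k k = A k k * B k k.
Proof.
move=> lA lB; rewrite (immul_lower _ _ lA (ltnSn k)) big_ord_recr /=.
by rewrite big1 ?add0r// => j _; rewrite (lB j k) ?mulr0.
Qed.

Lemma immulA A B C : lower_triangular A -> lower_triangular B ->
  immul A (immul B C) = immul (immul A B) C.
Proof.
move=> lA lB; apply/funext => i; apply/funext => l.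
rewrite (immul_lower _ _ lA (ltnSn i)).
rewrite (immul_lower _ _ (lower_mul lA lB) (ltnSn i)).
under eq_bigr => j _ do
  rewrite (immul_lower _ _ lB (ltn_ord j)) mulr_sumr.
rewrite exchange_big /=; apply: eq_bigr => j _.
rewrite (immul_lower _ _ lA (ltnSn i)) mulr_suml.
by apply: eq_bigr => k _; rewrite mulrA.
Qed.

Lemma lower_one : lower_triangular imone.
Proof. by move=> j k jk; rewrite /imone ltn_eqF. Qed.

Lemma im1mul A : immul imone A = A.
Proof.
apply/funext => i; apply/funext => k.
rewrite (immul_lower _ _ lower_one (ltnSn i)) big_ord_recr /= big1 => [|j _].
  by rewrite /imone eqxx mul1r add0r.
by rewrite /imone gtn_eqF ?mul0r.
Qed.

Lemma immul1 A : lower_triangular A -> immul A imone = A.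
Proof.
move=> lA; apply/funext => i; apply/funext => k.
case: (ltnP i k) => [ik|ki].
  by rewrite (lower_mul lA lower_one) ?lA.
rewrite (immul_lower _ _ lA (ltnSn i)) -ltnS in ki *.
rewrite (bigD1 (Ordinal ki)) //= big1 => [|j /negPf jk].
  by rewrite /imone eqxx mulr1 addr0.
by rewrite /imone; move: jk; rewrite -val_eqE /= => ->; rewrite mulr0.
Qed.

(* Forward substitution for the equation A B = 1; the first argument is fuel. *)
Fixpoint iminv_rec A (n i k : nat) : F :=
  if n is n'.+1 then
    (A i i)^-1 * (imone i k - \sum_(j < i) A i j * iminv_rec A n' j k)
  else 0.

Definition iminv A : imatrix F := fun i k => iminv_rec A i.+1 i k.

Lemma iminv_recE A n i k : (i < n)%N -> iminv_rec A n i k = iminv A i k.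
Proof.
suff E m n' j : (j < n')%N -> (j < m)%N -> iminv_rec A n' j k = iminv_rec A m j k.
  by move=> iN; exact: E.
elim: n' j m => [//|n' IHn] j [//|m] jn jm /=.
congr (_ * (_ - _)); apply: eq_bigr => l _; congr (_ * _).
by apply: IHn; apply: leq_trans (ltn_ord l) _.
Qed.

Lemma iminvE A i k :
  iminv A i k = (A i i)^-1 * (imone i k - \sum_(j < i) A i j * iminv A j k).
Proof.
rewrite {1}/iminv /=; congr (_ * (_ - _)); apply: eq_bigr => j _.
by rewrite iminv_recE.
Qed.

Lemma lower_inv A : lower_triangular (iminv A).
Proof.
move=> i k; elim/ltn_ind: i => i IHi ik.
rewrite iminvE lower_one// big1 ?subrr ?mulr0// => j _.
by rewrite IHi ?mulr0// (ltn_trans (ltn_ord j) ik).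
Qed.

Lemma immulV A : lower_triangular A -> (forall k, A k k != 0) ->
  immul A (iminv A) = imone.
Proof.
move=> lA dA; apply/funext => i; apply/funext => k.
rewrite (immul_lower _ _ lA (ltnSn i)) big_ord_recr /=.
by rewrite [iminv A i k]iminvE mulrA mulfV// mul1r addrC subrK.
Qed.

Lemma diag_inv A k : lower_triangular A -> (forall j, A j j != 0) ->
  iminv A k k != 0.
Proof.
move=> lA dA; apply/eqP => Bk0.
have := diag_mul k lA (lower_inv A).
rewrite immulV// Bk0 mulr0 /imone eqxx => /eqP.
by rewrite oner_eq0.
Qed.

End InfiniteMatrices.

Arguments imone {F}.
Arguments imshift {F}.

Record lowtri (F : fieldType) := Lowtri {
  lowtri_mx :> imatrix F;
  lowtriP : lower_triangular lowtri_mx;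
  lowtri_diag : forall k, lowtri_mx k k != 0
}.

Section LowtriGroup.
Variable F : fieldType.
Local Notation G := (lowtri F).
Implicit Types P Q : G.

Lemma lowtri_inj P Q : lowtri_mx P = lowtri_mx Q -> P = Q.
Proof.
case: P Q => [A lA dA] [B lB dB] /= AB; case: B / AB lB dB => lB dB.
by congr Lowtri; exact: Prop_irrelevance.
Qed.

HB.instance Definition _ := gen_eqMixin G.
HB.instance Definition _ := gen_choiceMixin G.

Lemma lowtri_mul_diag P Q k : immul P Q k k != 0.
Proof.
by rewrite diag_mul ?mulf_neq0 ?lowtri_diag//; exact: lowtriP.
Qed.

Lemma lowtri_one_diag k : @imone F k k != 0.
Proof. by rewrite /imone eqxx oner_eq0. Qed.

Definition lowtri_mul P Q : G :=
  Lowtri (lower_mul (@lowtriP _ P) (@lowtriP _ Q)) (lowtri_mul_diag P Q).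

Definition lowtri_one : G := Lowtri (@lower_one F) lowtri_one_diag.

Definition lowtri_inv P : G :=
  Lowtri (@lower_inv F P) (fun k => diag_inv k (@lowtriP _ P) (@lowtri_diag _ P)).

Lemma lowtri_mulA : associative lowtri_mul.
Proof. by move=> P Q S; apply/lowtri_inj/immulA; exact: lowtriP. Qed.

Lemma lowtri_mul1g : left_id lowtri_one lowtri_mul.
Proof. by move=> P; apply/lowtri_inj/im1mul. Qed.

Lemma lowtri_mulg1 : right_id lowtri_one lowtri_mul.
Proof. by move=> P; apply/lowtri_inj/immul1/lowtriP. Qed.

Lemma lowtri_mulgV : right_inverse lowtri_one lowtri_inv lowtri_mul.
Proof.
by move=> P; apply/lowtri_inj/immulV; [exact: lowtriP|exact: lowtri_diag].
Qed.

Lemma lowtri_mulVg : left_inverse lowtri_one lowtri_inv lowtri_mul.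
Proof.
move=> P; have PE : P = lowtri_inv (lowtri_inv P).
  rewrite -[LHS]lowtri_mulg1 -(lowtri_mulgV (lowtri_inv P)).
  by rewrite lowtri_mulA lowtri_mulgV lowtri_mul1g.
by rewrite {2}PE lowtri_mulgV.
Qed.

HB.instance Definition _ := isGroup.Build G
  lowtri_mulA lowtri_mul1g lowtri_mulg1 lowtri_mulVg lowtri_mulgV.

End LowtriGroup.

Definition monic_lowtri (F : fieldType) (P : lowtri F) : Prop :=
  forall k, P k k = 1.

Definition poly_of_lowtri (F : fieldType) (P : lowtri F) (k : nat) : {poly F} :=
  \poly_(j < k.+1) P k j.

Definition linearization_coefs (F : fieldType) (p : nat -> {poly F})
    (d : nat -> nat -> nat -> F) : Prop :=
  (forall n m, p n * p m = \sum_(k < (n + m).+1) d n m k *: p k) /\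
  (forall n m k, (n + m < k)%N -> d n m k = 0).

Section Linearization.
Variables (F : fieldType) (P : lowtri F).
Local Notation p := (poly_of_lowtri P).

Lemma poly_of_lowtri_basis N (q : {poly F}) : (size q <= N)%N ->
  exists c : nat -> F, q = \sum_(k < N) c k *: p k.
Proof.
elim: N q => [q|N IHN q szq].
  rewrite leqn0 size_poly_eq0 => /eqP ->.
  by exists (fun=> 0); rewrite big_ord0.
pose a := q`_N / P N N.
have [|c qE] := IHN (q - a *: p N).
  apply/leq_sizeP => j; rewrite leq_eqVlt coefB coefZ coef_poly.
  case/predU1P => [<-|Nj].
    by rewrite ltnSn /a divfK ?subrr// lowtri_diag.
  rewrite ltnS leqNgt Nj /= mulr0 subr0.
  by apply: (leq_sizeP _ _ szq).
exists (fun k => if k == N then a else c k).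
rewrite big_ord_recr /= eqxx -(subrK (a *: p N) q) {1}qE; congr (_ + _).
by apply: eq_bigr => k _; rewrite ltn_eqF.
Qed.

Lemma poly_of_lowtri_free N (c : nat -> F) :
  \sum_(k < N) c k *: p k = 0 -> forall k, (k < N)%N -> c k = 0.
Proof.
elim: N => [//|N IHN] s0.
have cN : c N = 0.
  have /eqP : (\sum_(k < N.+1) c k *: p k)`_N = 0 by rewrite s0 coef0.
  rewrite big_ord_recr /= coefD coef_sum big1 => [|k _].
    rewrite add0r coefZ coef_poly ltnSn mulf_eq0 (negPf (lowtri_diag P N)) orbF.
    by move/eqP.
  by rewrite coefZ coef_poly ltnS leqNgt ltn_ord /= mulr0.
move: s0; rewrite big_ord_recr /= cN scale0r addr0 => /IHN c0 k.
by rewrite ltnS leq_eqVlt => /predU1P[->//|/c0].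
Qed.

Lemma linearization_coefs_exist : exists d, linearization_coefs p d.
Proof.
have ex n m : exists c : nat -> F,
    p n * p m = \sum_(k < (n + m).+1) c k *: p k.
  apply: poly_of_lowtri_basis; apply: leq_trans (size_polyMleq _ _) _.
  by rewrite -subn1 leq_subLR add1n -addnS -addSn leq_add ?size_poly.
pose c n m := sval (cid (ex n m)).
exists (fun n m k => if (k <= n + m)%N then c n m k else 0); split => n m.
  rewrite {1}(svalP (cid (ex n m))) -/(c n m).
  by apply: eq_bigr => k _; rewrite -ltnS ltn_ord.
by move=> k; rewrite ltnNge => /negPf ->.
Qed.

Lemma linearization_coefs_unique d d' :
  linearization_coefs p d -> linearization_coefs p d' -> d = d'.
Proof.
move=> [dE d0] [d'E d'0].
apply/funext => n; apply/funext => m; apply/funext => k.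
case: (ltnP (n + m) k) => [nmk|]; first by rewrite d0 ?d'0.
rewrite -ltnS => knm; apply/eqP; rewrite -subr_eq0; apply/eqP.
apply: (poly_of_lowtri_free (N := (n + m).+1) (c := fun k => d n m k - d' n m k)) => //.
under eq_bigr => j _ do rewrite scalerBl.
by rewrite sumrB -dE -d'E subrr.
Qed.

End Linearization.

(* Main.v *)
Require Import Defs.
From mathcomp Require Import all_boot all_order all_algebra reals.
From mathcomp Require Import ring.
Import GRing.Theory.
Local Open Scope ring_scope.

(** Since [H P = P X], the matrix [H] represents multiplication by [t] in the
basis [p]; monicity makes its superdiagonal equal to [1], so
[t p_n = p_(n+1) + \sum_(j <= n) H n j p_j].  Writing [t p_n p_m] as
[(t p_n) p_m] and as [p_n (t p_m)] expresses [p_(n+1) p_m] through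
[p_n p_(m+1)] and lower products; compare the coefficients in the basis [p]. *)

Section Recurrence.
Variables (F : fieldType) (P : lowtri F).
Local Notation p := (poly_of_lowtri P).
Local Notation H := (immul (immul P imshift) (P^-1)%g).

Lemma immul_lower_shift n k :
  immul P imshift n k = if k is k'.+1 then P n k' else 0.
Proof.
case: (ltnP n k) => [nk|kn].
  rewrite (@immul_lower _ _ _ k) //; last exact: lowtriP.
  case: k nk => // k nk; rewrite big_ord_recr /= big1 => [|j _].
    by rewrite /imshift eqxx mulr1 add0r.
  by rewrite /imshift eqSS gtn_eqF ?mulr0.
rewrite (@immul_lower _ _ _ n.+1) //; last exact: lowtriP.
case: k kn => [_|k kn]; first by rewrite big1 // => j _; rewrite /imshift mulr0.
rewrite (bigD1 (Ordinal (ltnW kn : (k < n.+1)%N))) //= big1 => [|j].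
  by rewrite /imshift eqxx mulr1 addr0.
by rewrite -val_eqE /= eq_sym /imshift eqSS => /negPf ->; rewrite mulr0.
Qed.

Lemma immul_lower_shift0 n k : (n.+1 < k)%N -> immul P imshift n k = 0.
Proof. by rewrite immul_lower_shift; case: k => // k nk; exact: lowtriP. Qed.

(** This is [H P = P X]. As [P X] is not lower triangular, [immulA] does not apply; but row [n] of
    [P X] vanishes beyond column [n+1], so every sum can be cut at [n+2] and the two summations
    exchanged. *)
Lemma shift_conj_mul n k :
  \sum_(j < n.+2) H n j * P j k = immul P imshift n k.
Proof.
have HE j : H n j =
    \sum_(l < n.+2) immul P imshift n l * (P^-1)%g l j.
  by apply: immul_rowfinite => l; exact: immul_lower_shift0.
under eq_bigr do rewrite HE mulr_suml.
rewrite exchange_big /=.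
have VP : immul (P^-1)%g P = imone.
  by rewrite -[LHS]/(lowtri_mx (lowtri_mul (lowtri_inv P) P)) lowtri_mulVg.
transitivity (\sum_(l < n.+2) immul P imshift n l * imone l k).
  apply: eq_bigr => l _; rewrite -VP.
  rewrite [immul (P^-1)%g P l k](@immul_lower _ _ _ n.+2) //; last exact: lowtriP.
  by rewrite mulr_sumr; apply: eq_bigr => j _; rewrite mulrA.
(* The identity matrix selects the term [l = k] if [k] is in range; otherwise both sides are
   zero. *)
case: (ltnP k n.+2) => [kn|nk]; last first.
  rewrite immul_lower_shift0 // big1 // => l _.
  by rewrite /imone ltn_eqF ?mulr0 // (leq_trans (ltn_ord l)).
rewrite (bigD1 (Ordinal kn)) //= big1 => [|l].
  by rewrite /imone eqxx mulr1 addr0.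
by rewrite -val_eqE /imone /= => /negPf ->; rewrite mulr0.
Qed.

Lemma coef_poly_of_lowtri n k : (p n)`_k = P n k.
Proof.
by rewrite coef_poly; case: ltnP => // nk; rewrite lowtriP.
Qed.

(** Row [n] of [H P = P X], read as coefficients: shifting the columns of [P] is multiplication by
    ['X]. *)
Lemma mulX_poly_of_lowtri n : 'X * p n = \sum_(j < n.+2) H n j *: p j.
Proof.
apply/polyP => k; rewrite coefXM coef_sum coef_poly_of_lowtri.
under eq_bigr do rewrite coefZ coef_poly_of_lowtri.
by rewrite shift_conj_mul immul_lower_shift; case: k.
Qed.

(** At column [n+1] of row [n], [H P = P X] retains only the term [j = n+1], since [P] is lower
    triangular. *)
Lemma shift_conj_superdiag n : monic_lowtri P -> H n n.+1 = 1.
Proof.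
move=> P1; have := shift_conj_mul n n.+1.
rewrite immul_lower_shift P1 big_ord_recr /= P1 mulr1 big1 ?add0r // => j _.
by rewrite lowtriP ?mulr0.
Qed.

Lemma poly_of_lowtriS n : monic_lowtri P ->
  p n.+1 = 'X * p n - H n n *: p n - \sum_(j < n) H n j *: p j.
Proof.
move=> P1; rewrite mulX_poly_of_lowtri !big_ord_recr /= shift_conj_superdiag //.
by rewrite scale1r [_ + p n.+1]addrC addrA !addrK.
Qed.

(** Zero padding lets products of different degrees share one summation range. *)
Lemma linearization_coefsE d N n m : linearization_coefs p d ->
  (n + m < N)%N -> p n * p m = \sum_(k < N) d n m k *: p k.
Proof.
move=> [dE d0] nmN; rewrite dE (big_ord_widen N (fun k => d n m k *: p k)) //.
rewrite big_mkcond; apply: eq_bigr => k _; case: ltnP => // nmk.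
by rewrite d0 ?scale0r.
Qed.

Lemma linearization_coefs_recurrence d : monic_lowtri P ->
  linearization_coefs p d -> forall n m k,
  d n.+1 m k = d n m.+1 k + (H m m - H n n) * d n m k
    + \sum_(j < m) H m j * d n j k - \sum_(j < n) H n j * d m j k.
Proof.
(* [N] exceeds both [n+m+1], the largest degree involved, and [k], the index at which coefficients
   are compared. *)
move=> P1 dP n m k; pose N := (n + m + k).+2.
have E a b : (a + b <= (n + m).+1)%N ->
    p a * p b = \sum_(l < N) d a b l *: p l.
  move=> ab; apply: linearization_coefsE => //.
  by rewrite ltnS (leq_trans ab) // ltnS leq_addr.
have E_sum (c : nat -> F) a b : (a + b <= (n + m).+1)%N ->
    \sum_(l < N) (\sum_(j < b) c j * d a j l) *: p l
    = p a * \sum_(j < b) c j *: p j.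
  move=> ab; rewrite mulr_sumr.
  under eq_bigr do rewrite scaler_suml.
  rewrite exchange_big; apply: eq_bigr => j _ /=.
  rewrite -scalerAr E ?(leq_trans _ ab) ?leq_add2l 1?ltnW // scaler_sumr.
  by apply: eq_bigr => l _; rewrite scalerA.
apply/eqP; rewrite -subr_eq0; apply/eqP.
apply: (@poly_of_lowtri_free _ P N (fun k => d n.+1 m k -
  (d n m.+1 k + (H m m - H n n) * d n m k
    + \sum_(j < m) H m j * d n j k - \sum_(j < n) H n j * d m j k))); last first.
  by rewrite !ltnS (leq_trans (leq_addl (n + m) k)).
under eq_bigr do rewrite scalerBl scalerBl !scalerDl -scalerA.
rewrite !(sumrB, big_split) /= -scaler_sumr !E_sum ?leqnSn //; last first.
  by rewrite addnC leqnSn.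
(* What remains is an identity between products of the [p]. Expanding [p n.+1] and [p m.+1] makes
   the two terms ['X * p n * p m] cancel, and the lower sums match by commutativity. *)
rewrite -!E ?addSn ?addnS ?leqnSn // !poly_of_lowtriS //.
by rewrite -!mul_polyC polyCB; ring.
Qed.

End Recurrence.

Theorem theorem3p2 (R : realType) (P : lowtri R[i]) (H : imatrix R[i])
    (d : nat -> nat -> nat -> R[i])
    (monicP : monic_lowtri P)
    (HE : H = immul (immul P imshift) (P^-1)%g)
    (dP : linearization_coefs (poly_of_lowtri P) d) :
  forall n m k : nat,
    d n.+1 m k =
      d n m.+1 k + (H m m - H n n) * d n m k
      + \sum_(j < m) H m j * d n j k
      - \sum_(j < n) H n j * d m j k.
Proof. by rewrite HE; exact: linearization_coefs_recurrence. Qed.
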